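(* Let $\Omega$ be a $\sigma$-compact quasi-metric space with Radon measure $\mu$ and let $\Phi$ be a $\mu$-measurable function on $\Omega$. Let $(\mathfrak S,\rho,\nu)$ be a connected metric measure space and let a family $(A(u))_{u\in\Omega}\subseteq\mathrm{Iso}(\mathfrak S)$ be measurable and agree with the measure $\nu$. Let $1\le p<\infty$ and suppose that the Hajłasz–Sobolev space $M^{1,p}(\mathfrak S)$ is tame and separable. Then the Hausdorff-type operator $$(\mathcal H_{\Phi,A}f)(x)=\int_\Omega\Phi(u)f(A(u)(x))\,d\mu(u)$$ is bounded in $M^{1,p}(\mathfrak S)$ if $\Phi(\cdot)\,m(A(\cdot))^{-1/p}\in L^1(\mu)$, and in this case $$\|\mathcal H_{\Phi,A}\|\le\|\Phi\|_{A,p}:=\|\Phi(\cdot)\,m(A(\cdot))^{-1/p}\|_{L^1(\mu)}.$$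
   Context: $\mathrm{Iso}(\mathfrak S)$ is the group of bijective isometries of $(\mathfrak S,\rho)$, equipped with the compact-open topology (with which it is taken to be a locally compact topological group). A family $(A(u))_{u\in\Omega}\subseteq\mathrm{Iso}(\mathfrak S)$ is measurable if the map $u\mapsto A(u)$ is measurable as a map from the measure space $(\Omega,\mu)$ to the topological space $\mathrm{Iso}(\mathfrak S)$. The family agrees with the (positive) measure $\nu$ if for each measurable $E\subseteq\mathfrak S$ of finite measure and every $u\in\Omega$ the set $A(u)^{-1}(E)$ is measurable and $\nu(A(u)^{-1}(E))=m(A(u))^{-1}\nu(E)$ for some positive $\mu$-measurable function $u\mapsto m(A(u))$. $M^{1,p}(\mathfrak S)$ ($1\le p<\infty$) consists of the functions $f\in L^p(\nu)$ for which there exists $g\in L^p(\nu)$ such that $|f(x)-f(y)|\le\rho(x,y)(g(x)+g(y))$ for $\nu$-a.e. $x,y\in\mathfrak S$; it is a Banach space with norm $\|f\|_M=\|f\|_{L^p(\nu)}+\inf\|g\|_{L^p(\nu)}$, the infimum being over all $g\in L^p(\nu)$ satisfying this inequality. $M^{1,p}(\mathfrak S)$ is called tame if each bounded linear functional $L$ on $M^{1,p}(\mathfrak S)$ has the form $L(f)=\sum_{j=1}^\infty\int_{\mathfrak S}D_jf(x)\,v_j(x)\,d\nu(x)$ for some sequence $D_j$ of bounded operators on $M^{1,p}(\mathfrak S)$ and functions $v_j\in L^q(\nu)$ ($1/p+1/q=1$) such that $\sum_{j=1}^\infty\|D_j\|\,\|v_j\|_{L^q(\nu)}<\infty$. The paper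 assumes throughout that the integral defining $\mathcal H_{\Phi,A}f$ exists in the sense of Lebesgue. *)

(* Defs.v *)
From HB Require Import structures.
From mathcomp Require Import all_boot all_order all_algebra.
From mathcomp Require Import all_classical all_reals all_analysis.

Set Implicit Arguments.
Unset Strict Implicit.
Unset Printing Implicit Defensive.

Import Order.TTheory GRing.Theory Num.Theory.
Import numFieldNormedType.Exports.

Local Open Scope classical_set_scope.
Local Open Scope ring_scope.

(** * Quasi-metric spaces *)

Definition quasi_metric (R : realType) (T : Type) (d : T -> T -> R) : Prop :=
  [/\ forall x y, 0 <= d x y,
      forall x y, d x y = 0 <-> x = y,
      forall x y, d x y = d y x &
      exists2 K : R, 1 <= K & forall x y z, d x z <= K * (d x y + d y z)].

(* A type synonym carrying the topology of [d]: a set is open when it contains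
   a [d]-ball around each of its points.  The balls themselves need not be
   open when the triangle inequality only holds up to a constant. *)
Definition quasi_top (R : realType) (T : Type) (d : T -> T -> R) : Type := T.

Section quasi_topology.
Context (R : realType) (T : choiceType) (d : T -> T -> R).

Definition quasi_open : set (set (quasi_top d)) :=
  [set U | forall x, U x -> exists2 r : R, 0 < r &
                                [set y | d x y < r] `<=` U].

Let quasi_openT : quasi_open setT.
Proof. by move=> x _; exists 1. Qed.

Let quasi_openI : setI_closed quasi_open.
Proof.
move=> U V oU oV x [/oU[r r0 rU] /oV[s s0 sV]].
exists (Num.min r s); first by rewrite lt_min r0.
by move=> y /=; rewrite lt_min => /andP[/rU ? /sV ?].
Qed.

Let quasi_open_bigU (I : Type) (F : I -> set (quasi_top d)) :
  (forall i, quasi_open (F i)) -> quasi_open (\bigcup_i F i).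
Proof.
move=> oF x [i _ /oF[r r0 rF]]; exists r => // y /rF Fy.
by exists i.
Qed.

HB.instance Definition _ := Choice.on (quasi_top d).
HB.instance Definition _ := isOpenTopological.Build (quasi_top d)
  quasi_openT quasi_openI quasi_open_bigU.

End quasi_topology.

Definition sigma_compact (T : topologicalType) : Prop :=
  exists2 F : nat -> set T, (forall n, compact (F n)) & \bigcup_n F n = setT.

Definition locally_finite (R : realType) (d : measure_display)
    (T : measurableType d) (opn : set (set T)) (mu : set T -> \bar R) : Prop :=
  forall x, exists U, [/\ opn U, U x & (mu U < +oo)%E].

(* The sigma-algebra may be larger than the Borel one (e.g. its completion
   with respect to [mu]).  Since the space is not assumed to be locally
   compact, finiteness is required locally, not only on compact sets. *)
Definition radon (R : realType) (d : measure_display) (T : measurableType d)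
    (q : T -> T -> R) (mu : set T -> \bar R) : Prop :=
  [/\ forall U : set (quasi_top q), open U -> measurable (U : set T),
      locally_finite (@open (quasi_top q)) mu &
      forall E : set T, measurable E -> mu E = ereal_sup
        [set mu K | K in [set K : set (quasi_top q) | compact K /\ K `<=` E]]].

(** * Metric measure spaces *)

HB.mixin Record isBorelMetric (R : realType) (d : measure_display) T
    & Metric R T & Measurable d T := {
  measurable_borelE : @measurable d T = <<s @open T >>
}.

#[short(type="borelMetricType")]
HB.structure Definition BorelMetric (R : realType) (d : measure_display) :=
  {T of Metric R T & Measurable d T & isBorelMetric R d T}.

(* A metric measure space is a separable metric space with a locally finite
   Borel measure.  Both conditions hold, for instance, when all balls have
   positive and finite measure. *)
Definition metric_measure (R : realType) (d : measure_display)
    (S : borelMetricType R d) (nu : set S -> \bar R) : Prop :=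
  (exists2 D : set S, countable D & dense D) /\ locally_finite (@open S) nu.

(** * The isometry group *)

(* [set_type] carries the subspace topology. *)
Definition Iso (R : realType) (S : metricType R) :=
  set_type [set f : {compact-open, S -> S} |
    (forall x y : S, mdist (f x) (f y) = mdist x y) /\
    bijective (f : S -> S)].

HB.instance Definition _ (R : realType) (S : metricType R) :=
  Topological.copy (Iso S) (initial_topology (@set_val {compact-open, S -> S} _)).

Definition iso_fun (R : realType) (S : metricType R) (a : Iso S) : S -> S :=
  \val a.
Coercion iso_fun : Iso >-> Funclass.

Definition measurable_family (R : realType) (d : measure_display)
    (Omega : measurableType d) (S : metricType R) (A : Omega -> Iso S) : Prop :=
  forall U : set (Iso S), open U -> measurable (A @^-1` U).

Definition agrees_with (R : realType) (d d' : measure_display)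
    (Omega : measurableType d) (S : borelMetricType R d')
    (A : Omega -> Iso S) (nu : set S -> \bar R) (m : Iso S -> R) : Prop :=
  [/\ forall u, 0 < m (A u),
      measurable_fun setT (fun u => m (A u)) &
      forall u (E : set S), measurable E -> (nu E < +oo)%E ->
        measurable (A u @^-1` E) /\
        nu (A u @^-1` E) = (((m (A u))^-1)%:E * nu E)%E].

(** * Hajlasz-Sobolev spaces

   Elements of the space are represented by Borel functions, and functions
   equal almost everywhere are identified through the seminorm: an operator
   below is linear up to equality almost everywhere, and boundedness makes
   functionals and operators compatible with that equality. *)

Section hajlasz_sobolev.
Context (R : realType) (d : measure_display) (S : borelMetricType R d).
Context (nu : {measure set S -> \bar R}) (p : R).

Definition hajlasz_gradient (f : S -> R) : set (S -> R) :=
  [set g | g \in Lfun nu p%:E /\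
    exists2 N : set S, nu.-negligible N &
      forall x y, ~ N x -> ~ N y ->
        `|f x - f y| <= mdist x y * (g x + g y)].

Definition sobolev : set (S -> R) :=
  [set f | f \in Lfun nu p%:E /\ hajlasz_gradient f !=set0].

Definition sobolev_norm (f : S -> R) : \bar R :=
  ('N[nu]_p%:E[EFin \o f] +
   ereal_inf [set 'N[nu]_p%:E[EFin \o g] | g in hajlasz_gradient f])%E.

Definition sobolev_separable : Prop :=
  exists D : set (S -> R), [/\ countable D, D `<=` sobolev &
    forall f, sobolev f -> forall e : R, 0 < e ->
      exists2 g, D g & (sobolev_norm (f - g)%R < e%:E)%E].

Definition bounded_functional (L : (S -> R) -> R) : Prop :=
  (forall (a : R) f g, sobolev f -> sobolev g ->
     L (a *: f + g) = a * L f + L g) /\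
  (exists C : R, forall f, sobolev f ->
     (`|L f|%:E <= C%:E * sobolev_norm f)%E).

Definition operator_norm (T : (S -> R) -> (S -> R)) : \bar R :=
  ereal_sup [set sobolev_norm (T f) |
             f in [set f | sobolev f /\ (sobolev_norm f <= 1)%E]].

Definition bounded_operator (T : (S -> R) -> (S -> R)) : Prop :=
  [/\ forall f, sobolev f -> sobolev (T f),
      forall (a : R) f g, sobolev f -> sobolev g ->
        ae_eq nu setT (T (a *: f + g)) (a *: T f + T g) &
      (operator_norm T < +oo)%E].

Definition tame : Prop :=
  let q := hoelder_conjugate p%:E in
  forall L, bounded_functional L ->
    exists (D : nat -> (S -> R) -> (S -> R)) (v : nat -> S -> R),
    [/\ forall j, bounded_operator (D j),
        forall j, v j \in Lfun nu q,
        (\sum_(0 <= j <oo) operator_norm (D j) * 'N[nu]_q[EFin \o v j]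
           < +oo)%E &
        forall f, sobolev f ->
          series (fun j => \int[nu]_x (D j f x * v j x)) @ \oo --> L f].

End hajlasz_sobolev.

(** * Hausdorff-type operators *)

Section hausdorff_operator.
Context (R : realType) (d d' : measure_display).
Context (Omega : measurableType d) (S : borelMetricType R d').
Context (mu : {measure set Omega -> \bar R}) (Phi : Omega -> R).
Context (A : Omega -> Iso S).

Definition hausdorff_op (f : S -> R) : S -> R :=
  fun x => \int[mu]_u (Phi u * f (A u x)).

Definition hausdorff_op_exists (nu : {measure set S -> \bar R}) (p : R) :
    Prop :=
  forall f, sobolev nu p f -> {ae nu, forall x,
    mu.-integrable setT (fun u => (Phi u * f (A u x))%:E)}.

Definition hausdorff_weight (m : Iso S -> R) (p : R) : Omega -> R :=
  fun u => Phi u * m (A u) `^ (- p^-1).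

End hausdorff_operator.

(* Main.v *)
Require Import Defs.
From HB Require Import structures.
From mathcomp Require Import all_boot all_order all_algebra.
From mathcomp Require Import all_classical all_reals all_analysis.
From mathcomp Require Import measurable_realfun.

Set Implicit Arguments.
Unset Strict Implicit.
Unset Printing Implicit Defensive.

Import Order.TTheory GRing.Theory Num.Theory.
Import numFieldNormedType.Exports.

Local Open Scope classical_set_scope.
Local Open Scope ring_scope.

(** Why the theorem holds.  Write [w u = |Phi u| m(A u)^(-1/p)] and
    [W = int w dmu], the asserted bound for the operator norm.  The Hausdorff
    operator [H] is a superposition of the composition operators
    [f |-> f o A(u)], and change of variables shows that each of them multiplies
    the norm of L^p(nu) by at most [m(A u)^(-1/p)].  Two facts then suffice.

    The first is the bound by [W] of the positive operator
    [f |-> int |Phi u| |f(A(u) x)| dmu(u)] on L^p(nu), [Lnorm_abs_average].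
    The integrand is [w u] times [m(A u)^(1/p) |f(A(u) x)|], so the power-mean
    inequality for the weight [w] ([weighted_power_mean]) bounds the p-th power
    of the integral by
    [W^(p-1) int w(u) m(A u) |f(A(u) x)|^p dmu(u)];
    integrating in [x] and exchanging the integrals, the factor [m(A u)] cancels
    against the Jacobian of [A u], and what remains is [W^p] times the p-th power
    of the norm of [f].

    The second is that Hajlasz gradients are transported:
    if [g] is a gradient of [f], then [G x = int |Phi u| |g(A(u) x)| dmu(u)] is a
    gradient of [H f], because the [A u] preserve distances:
    [|H f x - H f y| <= int |Phi u| rho(A(u) x, A(u) y) (|g(A(u) x)| + |g(A(u) y)|)]
    and [rho(A(u) x, A(u) y) = rho(x, y)] leaves the integral
    ([hajlasz_gradient_hausdorff]).  The exceptional null set is harmless, since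
    by Tonelli almost every point [x] has [A(u) x] outside it for almost all [u]
    ([ae_comp_family]).  As [G] has norm at most [W] times that of [g], both
    terms of the Sobolev norm are multiplied by at most [W].

    All of this rests on Tonelli's theorem, hence on the sigma-finiteness of
    [mu] (sigma-compactness and local finiteness) and of [nu] (separability and
    local finiteness), and on the joint measurability of [(u, x) |-> A(u) x]
    ([measurable_isometry_family]), which follows from the separability of the
    space and the equicontinuity of isometries. *)

(** * Sigma-finiteness *)

(** Otherwise the differences of [K] with the members of [D] generate a proper
    filter on [K], and no member of [D] can be a neighbourhood of a cluster point
    of that filter. *)
Lemma compact_sub_directed_open (T : topologicalType) (K : set T)
    (D : set (set T)) :
  compact K -> D set0 -> (forall U V, D U -> D V -> D (U `|` V)) ->
  (forall x, K x -> exists2 U, D U & nbhs x U) ->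
  exists2 U, D U & K `<=` U.
Proof.
move=> cK D0 DU Dx; apply: contrapT => noU.
pose F := filter_from D (fun U => K `\` U).
have FF : ProperFilter F.
  apply: filter_from_proper; last first.
    move=> U DU'; apply: contrapT => KU; apply: noU; exists U => // x Kx.
    by apply: contrapT => Ux; apply: KU; exists x.
  apply: filter_from_filter; first by exists set0.
  move=> U V DU' DV; exists (U `|` V); first exact: DU.
  by move=> x [Kx UVx]; split; split=> // ?; apply: UVx; [left|right].
have FK : F K by exists set0 => // x [].
have [x [Kx clx]] := cK _ FF FK.
have [U DU' xU] := Dx x Kx.
have FKU : F (K `\` U) by exists U.
by have [y [[_ nUy] Uy]] := clx _ _ FKU xU.
Qed.

(** Sigma-finiteness asks for a sequence of sets; the [n]-th one is the member
    of [C] with code [n], or the empty set when there is none. *)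
Lemma sigma_finite_countable_cover (R : realType) (d : measure_display)
    (T : measurableType d) (mu : {measure set T -> \bar R}) (C : set (set T)) :
  countable C -> (forall U, C U -> measurable U /\ (mu U < +oo)%E) ->
  \bigcup_(U in C) U = setT -> sigma_finite setT mu.
Proof.
move=> /countable_injP[f finj] Cfin Ccov.
exists (fun n => \bigcup_(U in [set U | C U /\ f U = n]) U).
  apply/esym; rewrite -subTset -Ccov => x [U CU Ux].
  by exists (f U) => //; exists U.
move=> n; have [[U [CU fU]]|noU] := pselect (exists U, C U /\ f U = n).
  rewrite (_ : \bigcup_(_ in _) _ = U); first exact: Cfin.
  apply/seteqP; split=> [x [V [CV fV] Vx]|x Ux]; last by exists U.
  suff -> : U = V by [].
  by apply: finj; rewrite ?inE// fU fV.
rewrite (_ : \bigcup_(_ in _) _ = set0) ?measure0//.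
by apply/seteqP; split=> // x [V CV _]; apply: noU; exists V.
Qed.

(** The open sets of finite measure are directed and cover every point, so
    each compact set of the exhaustion lies in one of them. *)
Lemma radon_sigma_finite (R : realType) (d : measure_display)
    (T : measurableType d) (q : T -> T -> R)
    (mu : {measure set T -> \bar R}) :
  sigma_compact (quasi_top q) -> radon q mu -> sigma_finite setT mu.
Proof.
move=> [K cK covK] [mopen finopen _].
have KU n : exists2 U : set (quasi_top q),
    open U /\ (mu (U : set T) < +oo)%E & K n `<=` U.
  apply: (compact_sub_directed_open (cK n)).
  - by split; [exact: open0|rewrite measure0].
  - move=> U V [oU fU] [oV fV]; split; first exact: openU.
    apply: (le_lt_trans (measureU2 mu (mopen _ oU) (mopen _ oV))).
    exact: lte_add_pinfty.
  - move=> x _; have [U [oU Ux fU]] := finopen x.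
    by exists U => //; exact: open_nbhs_nbhs.
pose U n := s2val (cid2 (KU n)).
exists (U : nat -> set T) => [|n].
  apply/esym; rewrite -subTset -covK => x [n _ Knx].
  by exists n => //; exact: (s2valP' (cid2 (KU n))).
have [oU fU] := s2valP (cid2 (KU n)); split => //; exact: mopen.
Qed.

(** Equality of bundled measures is extensional, so a sigma-finite measure may be
    replaced everywhere by one that carries the structure needed for Tonelli. *)
Lemma sigma_finite_measure_ex (R : realType) (d : measure_display)
    (T : measurableType d) (mu : {measure set T -> \bar R}) :
  sigma_finite setT mu ->
  exists mu' : {sigma_finite_measure set T -> \bar R},
    mu = mu' :> {measure set T -> \bar R}.
Proof.
move=> sfin.
pose H1 := @isSFinite.Build _ _ _ (Measure.sort mu)
  (sfinite_measure_sigma_finite sfin).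
pose H2 := @isSigmaFinite.Build _ _ _ (Measure.sort mu) sfin.
exists (HB.pack_for (SigmaFiniteMeasure.type T R) (Measure.sort mu) H1 H2).
exact: eq_measure.
Qed.

(** * Separable metric spaces and families of isometries *)

Section separable_metric.
Context (R : realType) (d : measure_display) (S : borelMetricType R d).

Lemma open_measurable_borel (U : set S) : open U -> measurable U.
Proof. by rewrite measurable_borelE => oU; exact: sub_sigma_algebra. Qed.

Lemma open_mball (x : S) (r : R) : open [set y : S | mdist x y < r].
Proof.
rewrite openE => y /= xy; apply/nbhs_ballP; exists (r - mdist x y) => /=.
  by rewrite subr_gt0.
move=> z; rewrite ballEmdist /= => yz.
by rewrite (le_lt_trans (metric_triangle x y z))// addrC -ltrBrDr.
Qed.

Lemma dense_mdist_lt (D : set S) (x : S) (r : R) : dense D -> 0 < r ->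
  exists2 z, D z & mdist z x < r.
Proof.
move=> dD r0; have [] := dD _ _ (open_mball x r).
  by exists x; rewrite /= mdistxx.
by move=> z [/= xz Dz]; exists z => //; rewrite metric_sym.
Qed.

Lemma open_mdist_gt0 (U : set S) (x : S) : open U -> U x ->
  exists2 r : R, 0 < r & [set y | mdist x y < r] `<=` U.
Proof.
move=> oU Ux; have /nbhs_ballP[r /= r0 rU] := open_nbhs_nbhs (conj oU Ux).
by exists r => // y xy; apply: rU; rewrite ballEmdist.
Qed.

Lemma invSn_lt (r : R) : 0 < r -> exists n : nat, n.+1%:R^-1 < r.
Proof.
move=> r0; have [n _ nr] := near_infty_natSinv_lt (PosNum r0).
by exists n; exact: nr (leqnn n).
Qed.

(** The balls with centre in a countable dense set, radius [1/(n+1)] and finite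
    measure cover the space, since every point has a ball of finite measure
    around it. *)
Lemma metric_measure_sigma_finite (nu : {measure set S -> \bar R}) :
  metric_measure nu -> sigma_finite setT nu.
Proof.
move=> [[D cD dD] finnu].
pose b (zn : S * nat) := [set y : S | mdist zn.1 y < zn.2.+1%:R^-1].
pose C := [set U | (exists2 zn, (D `*` setT) zn & b zn = U) /\ (nu U < +oo)%E].
apply: (@sigma_finite_countable_cover _ _ _ _ C).
- apply: (@sub_countable _ _ _ (b @` (D `*` setT))).
    by apply: subset_card_le => U [].
  apply: (sub_countable (card_image_le _ _)); exact: countableX.
- by move=> U [[zn _ <-] ?]; split => //; exact/open_measurable_borel/open_mball.
- rewrite -subTset => x _; have [U [oU Ux Ufin]] := finnu x.
  have [r r0 rU] := open_mdist_gt0 oU Ux.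
  have [n nr] : exists n : nat, n.+1%:R^-1 < r / 2.
    by apply: invSn_lt; rewrite divr_gt0.
  have [z Dz zx] : exists2 z, D z & mdist z x < n.+1%:R^-1.
    by apply: dense_mdist_lt => //; rewrite invr_gt0.
  exists (b (z, n)) => //; split; first by exists (z, n).
  apply: le_lt_trans Ufin; apply: le_measure; rewrite ?inE.
  - exact/open_measurable_borel/open_mball.
  - exact: open_measurable_borel.
  - move=> y /= zy; apply: rU => /=.
    rewrite (le_lt_trans (metric_triangle x z y))// (metric_sym x z) [r]splitr.
    by rewrite ltrD// (lt_trans _ nr).
Qed.

(** Evaluation at a point is continuous because points are compact. *)
Lemma open_eval (x : S) (V : set S) : open V ->
  open [set a : Iso S | V (a x)].
Proof.
move=> oV.
have oU : open ([set g | g @` [set x] `<=` V] : set {compact-open, S -> S}).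
  by apply: compact_open_open => //; exact: compact_set1.
have -> : [set a : Iso S | V (a x)] =
    [set a : Iso S | [set g | g @` [set x] `<=` V] (\val a)].
  apply/seteqP; split=> a /=; first by move=> Va _ [_ -> <-].
  by move=> aV; apply: aV; exists x.
have := @initial_continuous _ _ (@set_val {compact-open, S -> S}
  [set f : {compact-open, S -> S} |
    (forall x y : S, mdist (f x) (f y) = mdist x y) /\
    bijective (f : S -> S)]).
by move=> /continuousP/(_ _ oU).
Qed.

Lemma iso_mdist (a : Iso S) (x y : S) : mdist (a x) (a y) = mdist x y.
Proof. have /= [iso _] := set_valP a; exact: iso. Qed.

(** For every [u], the point [A u x] is as close to [A u c] as [x] is to the
    point [c] of the dense set, so whether [A u x] lies in an open set [V] can be
    read off the values [A u c]: the preimage of [V] is a countable union of measurable rectangles, indexed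
    by [c] and by the precision of the approximation. *)
Lemma measurable_isometry_family (dO : measure_display)
    (Omega : measurableType dO) (A : Omega -> Iso S) :
  (exists2 D : set S, countable D & dense D) -> measurable_family A ->
  measurable_fun setT (fun z : Omega * S => A z.1 z.2).
Proof.
move=> [D /countable_injP[f finj] dD] mA.
apply: (measurability (@open S)); first exact: measurable_borelE.
move=> _ [V oV <-]; rewrite setTI.
(* The points having a ball of radius a little more than 1/(n+1) inside [V];
   the margin [e] makes this set open. *)
pose W (n : nat) := [set y : S | exists2 e : R, 0 < e &
  [set y' | mdist y y' < n.+1%:R^-1 + e] `<=` V].
have oW n : open (W n).
  rewrite openE => y [e e0 yV]; apply/nbhs_ballP; exists (e / 2) => /=.
    by rewrite divr_gt0.
  move=> y'; rewrite ballEmdist /= => yy'; exists (e / 2); first by rewrite divr_gt0.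
  move=> y'' /= y'y''; apply: yV => /=.
  rewrite (le_lt_trans (metric_triangle y y' y''))// [in ltRHS](splitr e).
  by rewrite addrA addrC ltrD.
(* The rectangle attached to the dense point of code [k]. *)
pose B n k := [set z : Omega * S | exists c : S,
  [/\ D c, f c = k, W n (A z.1 c) & mdist c z.2 < n.+1%:R^-1]].
have -> : (fun z : Omega * S => A z.1 z.2) @^-1` V =
    \bigcup_n \bigcup_k B n k.
  apply/seteqP; split=> [[u x] /= Vux | [u x] [n _ [k _ [c [_ _ [e e0 WV] /= dx]]]]].
    have [r r0 rV] := open_mdist_gt0 oV Vux.
    (* The three summands r/4, r/4 and r/2 below are the distance from [x] to
       [c], the radius 1/(n+1) and the margin [e]. *)
    have [n nr] : exists n : nat, n.+1%:R^-1 < r / 2 / 2.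
      by apply: invSn_lt; rewrite !divr_gt0.
    have [c Dd dx] : exists2 c, D c & mdist c x < n.+1%:R^-1.
      by apply: dense_mdist_lt => //; rewrite invr_gt0.
    exists n => //; exists (f c) => //; exists c; split => //=.
    exists (r / 2); first by rewrite divr_gt0.
    move=> y /= dy; apply: rV => /=.
    rewrite (le_lt_trans (metric_triangle _ (A u c) y))// iso_mdist (metric_sym x c).
    have : mdist c x + mdist (A u c) y < r / 2 / 2 + (r / 2 / 2 + r / 2).
      by rewrite ltrD// ?(lt_trans dx nr)// (lt_le_trans dy)// lerD2r ltW.
    by rewrite addrA -splitr -splitr.
  by apply: WV => /=; rewrite iso_mdist (lt_le_trans dx)// lerDl ltW.
apply: bigcup_measurable => n _; apply: bigcup_measurable => k _.
have [[c [Dd fdk]]|nod] := pselect (exists c, D c /\ f c = k); last first.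
  rewrite (_ : B n k = set0); first exact: measurable0.
  by apply/seteqP; split => // z [c [Dd fd _ _]]; apply: nod; exists c.
rewrite (_ : B n k = [set u | W n (A u c)] `*` [set x | mdist c x < n.+1%:R^-1]).
  apply: measurableX; last exact/open_measurable_borel/open_mball.
  exact: (mA _ (open_eval c (oW n))).
apply/seteqP; split=> [z [c1 [Dd' fd' Wd' c1z]]|z [/= Wd dz]]; last by exists c.
suff <- : c1 = c by [].
by apply: finj; rewrite ?inE// fdk.
Qed.

End separable_metric.

(** * Weighted power means *)

Section integral_inequalities.
Local Open Scope ereal_scope.
Context d (T : measurableType d) (R : realType).
Context (mu : {measure set T -> \bar R}).

(** Hoelder's inequality for [w^(1/p) h] and [w^(1/q)].  The exponent [p - 1] is
    [p/q], which makes the case [p = 1] an instance of the same formula, with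
    first factor [1]. *)
Lemma weighted_power_mean (w h : T -> R) (p : R) : (1 <= p)%R ->
  measurable_fun setT w -> measurable_fun setT h ->
  (forall t, 0 <= w t)%R -> (forall t, 0 <= h t)%R ->
  (\int[mu]_t (w t * h t)%:E) `^ p <=
  (\int[mu]_t (w t)%:E) `^ (p - 1) * \int[mu]_t (w t * h t `^ p)%:E.
Proof.
move=> p1 mw mh w0 h0.
have p0 : (0 < p)%R by exact: lt_le_trans p1.
have [pE|pN1] := eqVneq p 1%R.
  rewrite pE subrr poweRe0 mul1e poweRe1; last first.
    by apply: integral_ge0 => t _; rewrite lee_fin mulr_ge0.
  by under [leRHS]eq_integral do rewrite powRr1//.
have pm0 : (0 < p - 1)%R by rewrite subr_gt0 lt_neqAle eq_sym pN1.
pose q := (p / (p - 1))%R.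
have q0 : (0 < q)%R by rewrite divr_gt0.
have pq : (p^-1 + q^-1 = 1)%R.
  by rewrite /q invf_div -[X in (X + _)%R]mul1r -mulrDl addrC subrK divff// gt_eqF.
have qp : (q^-1 * p = p - 1)%R by rewrite /q invf_div divfK// gt_eqF.
have mwp r : measurable_fun setT (fun t => w t `^ r)%R.
  exact: (measurableT_comp (@measurable_powR R r)).
have := @hoelder _ _ _ mu (fun t => w t `^ p^-1 * h t)%R
  (fun t => w t `^ q^-1)%R p q (measurable_funM (mwp _) mh) (mwp _) p0 q0 pq.
rewrite Lnorm1 unlock.
have -> : \int[mu]_t `|(EFin \o ((fun t => w t `^ p^-1 * h t) \*
    (fun t => w t `^ q^-1))%R) t| = \int[mu]_t (w t * h t)%:E.
  apply: eq_integral => t _ /=.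
  rewrite mulrAC -powRD; last by rewrite pq oner_eq0.
  by rewrite pq powRr1// ger0_norm// mulr_ge0.
have -> : \int[mu]_t `|(EFin \o (fun t => w t `^ p^-1 * h t)%R) t| `^ p
    = \int[mu]_t (w t * h t `^ p)%:E.
  apply: eq_integral => t _ /=; congr EFin.
  rewrite ger0_norm; last by rewrite mulr_ge0// powR_ge0.
  by rewrite powRM ?powR_ge0// -powRrM mulVf ?powRr1// gt_eqF.
have -> : \int[mu]_t `|(EFin \o (fun t => w t `^ q^-1)%R) t| `^ q
    = \int[mu]_t (w t)%:E.
  apply: eq_integral => t _ /=; congr EFin.
  by rewrite ger0_norm ?powR_ge0// -powRrM mulVf ?powRr1// gt_eqF.
have I0 (f : T -> R) : (forall t, 0 <= f t)%R -> 0 <= \int[mu]_t (f t)%:E.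
  by move=> f0; apply: integral_ge0 => t _; rewrite lee_fin.
move=> H; apply: le_trans.
  apply: (gt0_ler_poweR (ltW p0) _ _ H); rewrite in_itv/= leey andbT.
    by apply: I0 => t; rewrite mulr_ge0.
  by rewrite mule_ge0// poweR_ge0.
rewrite poweRM ?poweR_ge0// -!poweRrM mulVf ?gt_eqF// qp muleC poweRe1//.
by apply: I0 => t; rewrite mulr_ge0 ?powR_ge0.
Qed.

Lemma Lnorm_le (F G : T -> \bar R) (p : R) : (0 < p)%R ->
  measurable_fun setT F -> measurable_fun setT G ->
  (forall x, `|F x| <= `|G x|) -> 'N[mu]_p%:E[F] <= 'N[mu]_p%:E[G].
Proof.
move=> p0 mF mG FG; rewrite unlock.
have I0 (H : T -> \bar R) : 0 <= \int[mu]_x `|H x| `^ p.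
  by apply: integral_ge0 => x _; rewrite poweR_ge0.
apply: gt0_ler_poweR; rewrite ?in_itv/= ?leey ?andbT//.
  by rewrite invr_ge0 ltW.
have mp (H : T -> \bar R) : measurable_fun setT H ->
    measurable_fun setT (fun x => `|H x| `^ p).
  move=> mH; apply: (measurableT_comp (measurable_poweR p)).
  exact: measurableT_comp.
apply: ge0_le_integral => //; try exact: mp.
- by move=> x _; rewrite poweR_ge0.
move=> x _; apply: gt0_ler_poweR; rewrite ?in_itv/= ?leey ?andbT//.
exact: ltW.
Qed.

Lemma abse_fine_le (y : \bar R) : `|(fine y)%:E| <= `|y|.
Proof. by case: y => //= *; rewrite normr0 leey. Qed.

End integral_inequalities.

(** * Averages over a measurable family of maps *)

(** [(M u)^-1] bounds the factor by which taking preimages under [phi u] enlarges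
    measures; for the isometries of the theorem it is their Jacobian. *)
Section averaging.
Context (R : realType) (dO dX : measure_display).
Context (Omega : measurableType dO) (X : measurableType dX).
Context (mu : {sigma_finite_measure set Omega -> \bar R}).
Context (nu : {sigma_finite_measure set X -> \bar R}).
Context (Phi M : Omega -> R) (phi : Omega -> X -> X) (p : R).
Hypothesis p1 : 1 <= p.
Hypothesis mPhi : measurable_fun setT Phi.
Hypothesis M0 : forall u, 0 < M u.
Hypothesis mM : measurable_fun setT M.
Hypothesis mphi : measurable_fun setT (fun z : Omega * X => phi z.1 z.2).
Hypothesis nuphi : forall u E, measurable E ->
  (nu (phi u @^-1` E) <= (M u)^-1%:E * nu E)%E.

Let p0 : 0 < p. Proof. exact: lt_le_trans p1. Qed.

Let mphiu u : measurable_fun setT (phi u).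
Proof. exact: (measurable_fun_pair2 u mphi). Qed.

Let weight u := Phi u * M u `^ (- p^-1).

Let w u := `|Phi u| * M u `^ (- p^-1).

Let w0 u : 0 <= w u. Proof. by rewrite mulr_ge0// powR_ge0. Qed.

Let mw : measurable_fun setT w.
Proof.
apply: measurable_funM; first exact: measurableT_comp.
exact: (measurableT_comp (@measurable_powR R _)).
Qed.

Let mlift (f : X -> R) : measurable_fun setT f ->
  measurable_fun setT (fun z : Omega * X => f (phi z.1 z.2)).
Proof. by move=> mf; exact: measurableT_comp mphi. Qed.

(** The integral of [f o phi u] is that of [f] for the image measure, which is
    dominated by [(M u)^-1 nu]. *)
Lemma ge0_integral_comp_le (f : X -> \bar R) u :
  measurable_fun setT f -> (forall x, (0 <= f x)%E) ->
  (\int[nu]_x f (phi u x) <= (M u)^-1%:E * \int[nu]_x f x)%E.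
Proof.
move=> mf f0; have Mu0 : 0 <= (M u)^-1 by rewrite invr_ge0 ltW.
have -> : (\int[nu]_x f (phi u x) = \int[pushforward nu (phi u)]_x f x)%E.
  by rewrite (ge0_integral_pushforward (mphiu u)).
rewrite -[leRHS](ge0_integral_mscale nu measurableT (NngNum Mu0))//.
apply: ge0_le_measure_integral => // E mE.
exact: nuphi.
Qed.

(** Extended-real valued: that it is finite almost everywhere is a consequence
    of the bound on its norm. *)
Definition abs_average (f : X -> R) (x : X) : \bar R :=
  (\int[mu]_u (`|Phi u| * `|f (phi u x)|)%:E)%E.

Lemma abs_average_ge0 f x : (0 <= abs_average f x)%E.
Proof. by apply: integral_ge0 => u _; rewrite lee_fin mulr_ge0. Qed.

Let mPhi1 : measurable_fun setT (fun z : Omega * X => Phi z.1).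
Proof. exact: measurableT_comp. Qed.

Lemma measurable_abs_average f : measurable_fun setT f ->
  measurable_fun setT (abs_average f).
Proof.
move=> mf; apply: (measurable_fun_fubini_tonelli_G
  (fun z : Omega * X => (`|Phi z.1| * `|f (phi z.1 z.2)|)%:E)).
- apply/measurable_EFinP; apply: measurable_funM; apply: measurableT_comp => //.
  exact: mlift.
- by move=> z; rewrite /= lee_fin mulr_ge0.
Qed.

(** A form of Minkowski's integral inequality.  Splitting the integrand as the
    weight [w u] times [M u ^ (1/p) |f (phi u x)|] before applying the power-mean
    inequality puts exactly the factor [M u] into the p-th power, and this
    factor is absorbed by the change of variables along [phi u]. *)
Lemma Lnorm_abs_average f : measurable_fun setT f ->
  ('N[nu]_p%:E[abs_average f] <=
   'N[mu]_1[EFin \o weight] * 'N[nu]_p%:E[EFin \o f])%E.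
Proof.
move=> mf; rewrite Lnorm1 unlock.
have -> : (\int[mu]_u `|(EFin \o weight) u| = \int[mu]_u (w u)%:E)%E.
  apply: eq_integral => u _ /=.
  by rewrite /weight normrM (ger0_norm (powR_ge0 _ _)).
set W := (\int[mu]_u (w u)%:E)%E.
have W0 : (0 <= W)%E by apply: integral_ge0 => u _; rewrite lee_fin.
set I := (\int[nu]_x `|(EFin \o f) x| `^ p)%E.
have I0 : (0 <= I)%E by apply: integral_ge0 => x _; rewrite poweR_ge0.
have mfp : measurable_fun setT (fun x => `|f x| `^ p).
  by apply: (measurableT_comp (@measurable_powR R p)); exact: measurableT_comp.
pose k (z : Omega * X) := (w z.1 * (M z.1 * `|f (phi z.1 z.2)| `^ p))%:E.
have k0 z : (0 <= k z)%E.
  by rewrite lee_fin !mulr_ge0// ?powR_ge0// ltW.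
have mk : measurable_fun setT k.
  apply/measurable_EFinP; apply: measurable_funM; first exact: measurableT_comp.
  by apply: measurable_funM; [exact: measurableT_comp|exact: (mlift mfp)].
have pointwise x : (`|abs_average f x| `^ p <=
    W `^ (p - 1) * \int[mu]_u k (u, x))%E.
  rewrite gee0_abs ?abs_average_ge0//.
  pose h u := M u `^ p^-1 * `|f (phi u x)|.
  have h0 u : 0 <= h u by rewrite mulr_ge0// powR_ge0.
  have mh : measurable_fun setT h.
    apply: measurable_funM; first exact: (measurableT_comp (@measurable_powR R _)).
    by apply: measurableT_comp => //; exact: (measurable_fun_pair1 x (mlift mf)).
  have -> : abs_average f x = (\int[mu]_u (w u * h u)%:E)%E.
    apply: eq_integral => u _; congr EFin.
    rewrite /w /h mulrA -[X in _ = X * _]mulrA -powRD; last first.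
      by rewrite addNr eqxx gt_eqF.
    by rewrite addNr powRr0 mulr1.
  have -> : (\int[mu]_u k (u, x) = \int[mu]_u (w u * h u `^ p)%:E)%E.
    apply: eq_integral => u _; congr EFin.
    rewrite /h powRM ?powR_ge0// -powRrM mulVf ?gt_eqF// powRr1// ltW//.
  exact: weighted_power_mean.
have key : (\int[nu]_x `|abs_average f x| `^ p <= W `^ p * I)%E.
  apply: (@le_trans _ _ (\int[nu]_x (W `^ (p - 1) * \int[mu]_u k (u, x)))%E).
    apply: ge0_le_integral => //.
    - by move=> x _; rewrite poweR_ge0.
    - apply: (measurableT_comp (measurable_poweR p)).
      by apply: measurableT_comp => //; exact: measurable_abs_average.
    - apply: measurable_funeM.
      exact: (measurable_fun_fubini_tonelli_G k).
  rewrite ge0_integralZl//; last 3 first.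
  - exact: (measurable_fun_fubini_tonelli_G k).
  - by move=> x _; apply: integral_ge0 => u _.
  - exact: poweR_ge0.
  rewrite -(fubini_tonelli k)//.
  have -> : (W `^ p * I = W `^ (p - 1) * (W * I))%E.
    rewrite muleA; congr (_ * _)%E.
    rewrite -[in RHS](poweRe1 W0) -poweRrM mul1r.
    rewrite -poweRD ?subrK//.
    by apply: add_neq0_poweRD_def; rewrite subrK gt_eqF.
  apply: lee_wpmul2l; first exact: poweR_ge0.
  rewrite /W -ge0_integralZr//; last 2 first.
  - exact/measurable_EFinP.
  - by move=> u _; rewrite lee_fin.
  apply: ge0_le_integral => //.
  - by move=> u _; apply: integral_ge0.
  - exact: (measurable_fun_fubini_tonelli_F k).
  - by apply: emeasurable_funM; [exact/measurable_EFinP|].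
  move=> u _.
  have -> : (\int[nu]_x k (u, x) =
      \int[nu]_x ((w u)%:E * ((M u)%:E * (`|f (phi u x)| `^ p)%:E)))%E.
    by apply: eq_integral => x _; rewrite -!EFinM.
  rewrite ge0_integralZl//; last 3 first.
  - apply: measurable_funeM; apply/measurable_EFinP.
    exact: (measurable_fun_pair2 u (mlift mfp)).
  - by move=> x _; rewrite mule_ge0// lee_fin ?powR_ge0// ltW.
  - by rewrite lee_fin.
  apply: lee_wpmul2l; first by rewrite lee_fin.
  rewrite ge0_integralZl//; last 2 first.
  - apply/measurable_EFinP.
    exact: (measurable_fun_pair2 u (mlift mfp)).
  - by rewrite lee_fin ltW.
  rewrite -lee_pdivlMl//.
  apply: (ge0_integral_comp_le (f := fun x => (`|f x| `^ p)%:E)).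
  - exact/measurable_EFinP.
  - by move=> x; rewrite lee_fin powR_ge0.
apply: (@le_trans _ _ ((W `^ p * I) `^ p^-1)%E).
  apply: gt0_ler_poweR => //.
  - by rewrite invr_ge0 ltW.
  - by rewrite in_itv/= leey andbT; apply: integral_ge0 => x _; rewrite poweR_ge0.
  - by rewrite in_itv/= leey andbT mule_ge0// poweR_ge0.
by rewrite poweRM ?poweR_ge0// -poweRrM mulfV ?gt_eqF// poweRe1.
Qed.


Definition average (f : X -> R) (x : X) : R :=
  \int[mu]_u (Phi u * f (phi u x)).

Lemma measurable_average f : measurable_fun setT f ->
  measurable_fun setT (average f).
Proof.
move=> mf; pose h (z : Omega * X) := (Phi z.1 * f (phi z.1 z.2))%:E.
have mh : measurable_fun setT h.
  by apply/measurable_EFinP; apply: measurable_funM => //; exact: mlift.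
rewrite (_ : average f = fine \o
    (fun x => \int[mu]_u h^\+ (u, x) - \int[mu]_u h^\- (u, x))%E); last first.
  apply/funext => x; rewrite /average /Rintegral /= [X in fine X = _]integralE.
  by congr (fine (_ - _)%E); apply: eq_integral => u _; rewrite ?funeposE ?funenegE.
apply: measurableT_comp => //; apply: emeasurable_funB.
- apply: (measurable_fun_fubini_tonelli_G (h^\+)%E) => //.
  exact: measurable_funepos.
- apply: (measurable_fun_fubini_tonelli_G (h^\-)%E) => //.
  exact: measurable_funeneg.
Qed.

Let mslice f x : measurable_fun setT f ->
  measurable_fun setT (fun u => (Phi u * f (phi u x))%:E).
Proof.
move=> mf; apply/measurable_EFinP; apply: measurable_funM => //.
exact: (measurable_fun_pair1 x (mlift mf)).
Qed.

Lemma average_le f x : measurable_fun setT f ->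
  (`|(average f x)%:E| <= abs_average f x)%E.
Proof.
move=> mf; apply: le_trans (abse_fine_le _) _.
apply: le_trans (le_abse_integral _ _ (mslice x mf)) _ => //.
rewrite le_eqVlt; apply/orP; left; apply/eqP.
by apply: eq_integral => u _; rewrite /= normrM.
Qed.

Lemma Lnorm_average f : measurable_fun setT f ->
  ('N[nu]_p%:E[EFin \o average f] <=
   'N[mu]_1[EFin \o weight] * 'N[nu]_p%:E[EFin \o f])%E.
Proof.
move=> mf; apply: le_trans (Lnorm_abs_average mf); apply: Lnorm_le => //.
- exact/measurable_EFinP/measurable_average.
- exact: measurable_abs_average.
- by move=> x; rewrite [leRHS]gee0_abs ?abs_average_ge0//; exact: average_le.
Qed.

Hypothesis weight_fin : ('N[mu]_1[EFin \o weight] < +oo)%E.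

Lemma Lnorm_abs_average_lty f : f \in Lfun nu p%:E ->
  ('N[nu]_p%:E[abs_average f] < +oo)%E.
Proof.
move=> /andP[/[!inE]/= mf]; rewrite /finite_norm => ffin.
apply: le_lt_trans (Lnorm_abs_average mf) _.
by rewrite lte_mul_pinfty// ?ge0_fin_numE ?Lnorm_ge0.
Qed.

Lemma ae_abs_average_fin f : f \in Lfun nu p%:E ->
  {ae nu, forall x, (abs_average f x < +oo)%E}.
Proof.
move=> fL; have := Lnorm_abs_average_lty fL.
move: fL => /andP[/[!inE]/= mf _].
rewrite unlock => /lty_poweRy; rewrite invr_eq0 gt_eqF// => /(_ isT) Ifin.
have : nu.-integrable setT (fun x => `|abs_average f x| `^ p)%E.
  apply/integrableP; split.
    apply: (measurableT_comp (measurable_poweR p)); apply: measurableT_comp => //.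
    exact: measurable_abs_average.
  under eq_integral do rewrite gee0_abs ?poweR_ge0//.
  exact: Ifin.
move=> /(integrable_ae measurableT); apply: filterS => x /(_ I).
rewrite fin_numE => /andP[_] /eqP Fp.
rewrite ltey; apply/eqP => Fx; apply: Fp.
by rewrite Fx /= gt_eqF.
Qed.

Lemma ae_average_integrable f : f \in Lfun nu p%:E ->
  {ae nu, forall x, mu.-integrable setT (fun u => (Phi u * f (phi u x))%:E)}.
Proof.
move=> fL; apply: filterS (ae_abs_average_fin fL) => x Fx.
move: fL => /andP[/[!inE]/= mf _].
apply/integrableP; split; first exact: mslice.
apply: le_lt_trans Fx; rewrite le_eqVlt; apply/orP; left; apply/eqP.
by apply: eq_integral => u _; rewrite /= normrM.
Qed.

(** If [N] is a null set containing the exceptions to [P], all the sets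
    [phi u @^-1` N] are null, so the set of pairs [(u, x)] with [phi u x] in [N]
    is null, and so are almost all of its sections in the other direction. *)
Lemma ae_comp_family (P : X -> Prop) : {ae nu, forall x, P x} ->
  {ae nu, forall x, {ae mu, forall u, P (phi u x)}}.
Proof.
move=> [N [mN nuN0 PN]].
pose k (z : Omega * X) := (\1_N (phi z.1 z.2))%:E : \bar R.
have k0 z : (0 <= k z)%E by rewrite lee_fin.
have mk : measurable_fun setT k by apply/measurable_EFinP; exact: mlift.
have I0 : (\int[nu]_x `|\int[mu]_u k (u, x)| = 0)%E.
  under eq_integral do rewrite gee0_abs ?integral_ge0//.
  rewrite -(fubini_tonelli k)//; apply: integral0_eq => u _.
  rewrite (_ : (fun x => k (u, x)) = fun x => (\1_(phi u @^-1` N) x)%:E)//.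
  have mpN : measurable (phi u @^-1` N).
    by rewrite -[X in measurable X]setTI; exact: mphiu.
  rewrite integral_indic// setIT; apply/eqP; rewrite eq_le measure_ge0 andbT.
  by rewrite (le_trans (nuphi u mN))// nuN0 mule0.
have mG : measurable_fun setT (fun x => \int[mu]_u k (u, x))%E.
  exact: (measurable_fun_fubini_tonelli_G k).
move: I0 => /(ae_eq_integral_abs nu measurableT mG).
apply: filterS => x /(_ I) /= kx.
exists ((fun u => phi u x) @^-1` N).
have mux : measurable_fun setT (fun u => phi u x).
  exact: (measurable_fun_pair1 x mphi).
have mpN : measurable ((fun u => phi u x) @^-1` N).
  by rewrite -[X in measurable X]setTI; exact: mux.
split=> //; last by move=> u /= nP; apply: PN.
rewrite -[RHS]kx -(setIT (_ @^-1` _)) -integral_indic//.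
Qed.

End averaging.

(** * The Hausdorff operator on Hajlasz-Sobolev spaces *)

Section isometry_average.
Context (R : realType) (dO dS : measure_display).
Context (Omega : measurableType dO) (S : borelMetricType R dS).
Context (mu : {sigma_finite_measure set Omega -> \bar R}).
Context (nu : {sigma_finite_measure set S -> \bar R}).
Context (Phi M : Omega -> R) (A : Omega -> Iso S) (p : R).
Hypothesis p1 : 1 <= p.
Hypothesis mPhi : measurable_fun setT Phi.
Hypothesis M0 : forall u, 0 < M u.
Hypothesis mM : measurable_fun setT M.
Hypothesis mA : measurable_fun setT (fun z : Omega * S => A z.1 z.2).
Hypothesis nuA : forall u E, measurable E ->
  (nu (A u @^-1` E) <= (M u)^-1%:E * nu E)%E.
Let weight u := Phi u * M u `^ (- p^-1).
Hypothesis weight_fin : ('N[mu]_1[EFin \o weight] < +oo)%E.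

Let phi u : S -> S := A u.

Let p0 : 0 < p. Proof. exact: lt_le_trans p1. Qed.

Lemma Lfun_hausdorff f : f \in Lfun nu p%:E ->
  hausdorff_op mu Phi A f \in Lfun nu p%:E.
Proof.
move=> /andP[/[!inE]/= mf ffin]; apply/andP; split; rewrite inE/=.
  exact: (measurable_average mu mPhi mA mf).
rewrite /finite_norm.
apply: le_lt_trans
  (Lnorm_average mu (phi := phi) p1 mPhi M0 mM mA nuA mf) _.
by rewrite lte_mul_pinfty// ?ge0_fin_numE ?Lnorm_ge0.
Qed.

(** A gradient has to be real valued, hence [fine]; it only lowers absolute
    values, so the bound on the norm survives. *)
Lemma Lfun_fine_abs_average g : g \in Lfun nu p%:E ->
  fine \o abs_average mu Phi phi g \in Lfun nu p%:E /\
  ('N[nu]_p%:E[EFin \o (fine \o abs_average mu Phi phi g)] <=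
   'N[mu]_1[EFin \o weight] * 'N[nu]_p%:E[EFin \o g])%E.
Proof.
move=> gL; have Gfin := Lnorm_abs_average_lty (phi := phi)
  p1 mPhi M0 mM mA nuA weight_fin gL.
move: gL => /andP[/[!inE]/= mg _].
have mG : measurable_fun setT (abs_average mu Phi phi g).
  exact: measurable_abs_average.
have mfG : measurable_fun setT (fine \o abs_average mu Phi phi g).
  exact: measurableT_comp.
have GG : ('N[nu]_p%:E[EFin \o (fine \o abs_average mu Phi phi g)] <=
    'N[nu]_p%:E[abs_average mu Phi phi g])%E.
  apply: Lnorm_le => //; first exact/measurable_EFinP.
  by move=> x; exact: abse_fine_le.
split; last first.
  exact: le_trans GG (Lnorm_abs_average mu (phi := phi) p1 mPhi M0 mM mA nuA mg).
apply/andP; split; rewrite inE//=; exact: le_lt_trans GG Gfin.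
Qed.

(** The points allowed for the new gradient are those whose images avoid the
    null set of [g] for almost all [u] and where both integrals converge; there
    the inequality for [g] at [A u x] and [A u y] can be integrated in [u], with
    the distance [mdist (A u x) (A u y) = mdist x y] as a constant factor. *)
Lemma hajlasz_gradient_hausdorff f g :
  f \in Lfun nu p%:E -> hajlasz_gradient nu p f g ->
  hajlasz_gradient nu p (hausdorff_op mu Phi A f)
    (fine \o abs_average mu Phi phi g).
Proof.
move=> fL [gL [N negN fg]]; split; first by have [] := Lfun_fine_abs_average gL.
have aeN : {ae nu, forall x, {ae mu, forall u, ~ N (A u x)}}.
  apply: (ae_comp_family mu (phi := phi) mA nuA (P := fun x => ~ N x)).
  move: negN; congr (_.-negligible _); apply/seteqP.
  by split=> x /=; [move=> ? /(_ _)|move/contrapT].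
have aef := ae_average_integrable (phi := phi)
  p1 mPhi M0 mM mA nuA weight_fin fL.
have aeg := ae_abs_average_fin (phi := phi) p1 mPhi M0 mM mA nuA weight_fin gL.
pose Q x := [/\ {ae mu, forall u, ~ N (A u x)},
  mu.-integrable setT (fun u => (Phi u * f (A u x))%:E) &
  (abs_average mu Phi phi g x < +oo)%E].
have aeQ : {ae nu, forall x, Q x}.
  by apply: filterS3 aeN aef aeg => x *; split.
exists (~` Q); first exact: aeQ.
move=> x y /contrapT[Nx fx gx] /contrapT[Ny fy gy].
have mg : measurable_fun setT g by move: gL => /andP[/[!inE]].
have mgs z : measurable_fun setT (fun u => (`|Phi u| * `|g (A u z)|)%:E).
  apply/measurable_EFinP; apply: measurable_funM; apply: measurableT_comp => //.
  by apply: measurableT_comp => //; exact: (measurable_fun_pair1 z mA).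
have G0 z : (0 <= abs_average mu Phi phi g z)%E by exact: abs_average_ge0.
rewrite /hausdorff_op -RintegralB//.
rewrite -lee_fin EFin_normr_Rintegral//; last first.
  exact: (integrableB measurableT fx fy).
have mB : measurable_fun setT
    (fun u => (Phi u * f (A u x) - Phi u * f (A u y))%:E).
  exact: (measurable_int mu (integrableB measurableT fx fy)).
apply: le_trans (le_abse_integral mu measurableT mB) _.
rewrite EFinM EFinD !fineK ?ge0_fin_numE//.
rewrite -ge0_integralD//; last 2 first.
- exact: mgs.
- exact: mgs.
rewrite -ge0_integralZl_EFin//; last 3 first.
- by move=> u _; rewrite adde_ge0// lee_fin mulr_ge0.
- exact: emeasurable_funD (mgs x) (mgs y).
- exact: mdist_ge0.
apply: ae_ge0_le_integral => //.
- exact: measurableT_comp.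
- by move=> u _; rewrite mule_ge0 ?lee_fin ?mdist_ge0// adde_ge0// lee_fin mulr_ge0.
- by apply: measurable_funeM; exact: emeasurable_funD (mgs x) (mgs y).
apply: filterS2 Nx Ny => u Nux Nuy _.
rewrite -EFinD -EFinM/= lee_fin -mulrBr normrM -mulrDr mulrCA ler_wpM2l//.
apply: le_trans (fg _ _ Nux Nuy) _; rewrite iso_mdist ler_wpM2l ?mdist_ge0//.
by rewrite lerD// ler_norm.
Qed.

Lemma sobolev_hausdorff f : sobolev nu p f ->
  sobolev nu p (hausdorff_op mu Phi A f).
Proof.
move=> [fL [g fg]]; split; first exact: Lfun_hausdorff.
by exists (fine \o abs_average mu Phi phi g); exact: hajlasz_gradient_hausdorff.
Qed.

Lemma sobolev_norm_hausdorff f : sobolev nu p f ->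
  (sobolev_norm nu p (hausdorff_op mu Phi A f) <=
   'N[mu]_1[EFin \o weight] * sobolev_norm nu p f)%E.
Proof.
move=> [fL [g0 fg0]]; rewrite /sobolev_norm.
set W := ('N[mu]_1[EFin \o weight])%E.
have W0 : (0 <= W)%E by exact: Lnorm_ge0.
have inf_ge0 h : (0 <= ereal_inf
    [set 'N[nu]_p%:E[EFin \o g] | g in hajlasz_gradient nu p h])%E.
  by apply: le_ereal_inf_tmp => _ [g _ <-]; exact: Lnorm_ge0.
rewrite ge0_muleDr ?Lnorm_ge0//; apply: leeD.
  move: fL => /andP[/[!inE]/= mf _].
  exact: (Lnorm_average mu (phi := phi) p1 mPhi M0 mM mA nuA mf).
have le_inf g : hajlasz_gradient nu p f g ->
    (ereal_inf [set 'N[nu]_p%:E[EFin \o g] | g in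
      hajlasz_gradient nu p (hausdorff_op mu Phi A f)] <=
     W * 'N[nu]_p%:E[EFin \o g])%E.
  move=> fg; apply: le_trans (Lfun_fine_abs_average (proj1 fg)).2.
  apply: ereal_inf_lbound; exists (fine \o abs_average mu Phi phi g) => //.
  exact: hajlasz_gradient_hausdorff.
move: W0 weight_fin le_inf; rewrite -/W; case: W => [r| |]// r0 _ le_inf.
(* The infimum is multiplied by [r] through division, which excludes [r = 0];
   in that case the gradient [g0] already gives the bound [0]. *)
move: r0; rewrite lee_fin le_eqVlt => /predU1P[r0|r0].
  by have := le_inf _ fg0; rewrite -r0 !mul0e.
rewrite -lee_pdivrMl//; apply: le_ereal_inf_tmp => _ [g fg <-].
by rewrite lee_pdivrMl//; exact: le_inf.
Qed.

Lemma operator_norm_hausdorff :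
  (operator_norm nu p (hausdorff_op mu Phi A) <= 'N[mu]_1[EFin \o weight])%E.
Proof.
apply: ge_ereal_sup => _ [f [sf f1] <-].
apply: le_trans (sobolev_norm_hausdorff sf) _.
by rewrite -[leRHS]mule1 lee_wpmul2l// Lnorm_ge0.
Qed.

Lemma hausdorff_bounded_operator :
  bounded_operator nu p (hausdorff_op mu Phi A).
Proof.
split; [exact: sobolev_hausdorff| |exact: le_lt_trans operator_norm_hausdorff _].
move=> a f g [fL _] [gL _].
have aef := ae_average_integrable (phi := phi)
  p1 mPhi M0 mM mA nuA weight_fin fL.
have aeg := ae_average_integrable (phi := phi)
  p1 mPhi M0 mM mA nuA weight_fin gL.
apply: filterS2 aef aeg => x fx gx _.
rewrite /hausdorff_op /=.
rewrite -[(_ + _) x]/(a * _ + _) -RintegralZl// -RintegralD//; last first.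
  exact: (integrableZl measurableT a fx).
by apply: eq_Rintegral => u _; rewrite mulrDr mulrCA.
Qed.

End isometry_average.

Theorem theorem11 (R : realType)
  (dO : measure_display) (Omega : measurableType dO) (q : Omega -> Omega -> R)
  (hq : quasi_metric q) (hOmega : sigma_compact (quasi_top q))
  (mu : {measure set Omega -> \bar R}) (hmu : radon q mu)
  (Phi : Omega -> R) (hPhi : measurable_fun setT Phi)
  (dS : measure_display) (S : borelMetricType R dS)
  (nu : {measure set S -> \bar R}) (hS : metric_measure nu)
  (hconn : connected [set: S]) (hIso : locally_compact [set: Iso S])
  (A : Omega -> Iso S) (hA : measurable_family A)
  (m : Iso S -> R) (hm : agrees_with A nu m)
  (p : R) (hp : 1 <= p)
  (htame : tame nu p) (hsep : sobolev_separable nu p)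
  (hint : hausdorff_op_exists mu Phi A nu p)
  (hPhiA : hausdorff_weight Phi A m p \in Lfun mu 1) :
  bounded_operator nu p (hausdorff_op mu Phi A) /\
  (operator_norm nu p (hausdorff_op mu Phi A) <=
     'N[mu]_1[EFin \o hausdorff_weight Phi A m p])%E.
Proof.
have mA := measurable_isometry_family (proj1 hS) hA.
have [mu' muE] := sigma_finite_measure_ex (radon_sigma_finite hOmega hmu).
have [nu' nuE] := sigma_finite_measure_ex (metric_measure_sigma_finite hS).
subst mu nu.
have [m0 mm nuA] := hm.
(* The change of variables is known for sets of finite measure only; for the
   others the right-hand side is infinite. *)
have nuA_le u E : measurable E ->
    (nu' (A u @^-1` E) <= (m (A u))^-1%:E * nu' E)%E.
  move=> mE; have [Efin|] := ltP (nu' E) +oo%E.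
    by have [_ ->] := nuA u E mE Efin.
  rewrite leye_eq => /eqP ->.
  by rewrite gt0_muley ?leey// lte_fin invr_gt0.
have wfin : ('N[mu']_1[EFin \o hausdorff_weight Phi A m p] < +oo)%E.
  by move: hPhiA => /andP[_ /[!inE]].
split.
  exact: (hausdorff_bounded_operator hp hPhi m0 mm mA nuA_le wfin).
exact: (operator_norm_hausdorff hp hPhi m0 mm mA nuA_le wfin).
Qed.
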